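(* Fix an integer $m>0$ and a real $\mu$ with $\mu e^{\mu+1}\ge m+2$. For each even integer $N>0$ let $h=1/N$, $x_i=ih$ for $0\le i<N$, $\mathbb N_N=\{k\in\mathbb Z:-N/2\le k\le N/2-1\}$ and $S=\lceil e^{\mu+1}\ln(\pi N)-1\rceil$. Given as input the values $u(x_i)$ and $\alpha(x_i)\in(0,2]$, $0\le i<N$, put $\hat u_k=h\sum_{i=0}^{N-1}u(x_i)e^{-2\pi\mathbf i kx_i}$ for $k\in\mathbb N_N$. Then, as $N\to\infty$: (1) (fast scheme) all the $N$ values $$(-\Delta)^{\alpha(x_i)/2}_{N,h,F}u(x_i)=\sum_{s=0}^{S}(\alpha(x_i)-1)^s\sum_{k\in\mathbb N_N\setminus\{0\}}\frac{(4\pi^2k^2)^{1/2}}{\Gamma(s+1)}\,\frac{\ln^s(4\pi^2k^2)}{2^s}\,\hat u_k\,e^{2\pi\mathbf i kx_i},\qquad 0\le i<N,$$ can be computed, using the fast Fourier transform, in $O(N\ln^2N)$ operations; (2) (direct scheme) the evaluation of all the $N$ values $$(-\Delta)^{\alpha(x_i)/2}_{N,h}u(x_i)=\sum_{k\in\mathbb N_N}(4\pi^2k^2)^{\alpha(x_i)/2}\,\hat u_k\,e^{2\pi\mathbf i kx_i},\qquad 0\le i<N,$$ by the direct method requires $O(N^2\ln N)$ operations.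
   Context: Here $\mathbf i$ is the imaginary unit, $\Gamma$ is the Gamma function, $\ln^s(a)=(\ln a)^s$. The quantity in (2) is the discretization of the one-dimensional variable-order spectral fractional Laplacian $(-\Delta)^{\alpha(x)/2}u(x)=\sum_{k\in\mathbb Z}(4\pi^2k^2)^{\alpha(x)/2}u_ke^{2\pi\mathbf i kx}$ of a function $u$ on $[0,1]$ with periodic boundary conditions, with $0<\alpha(x)\le 2$ and $u_k=\int_0^1u(x)e^{-2\pi\mathbf i kx}\,dx$; the quantity in (1) is its approximation obtained by replacing, for $k\ne0$, $(4\pi^2k^2)^{\alpha(x_i)/2}$ by the degree-$S$ Taylor polynomial about $z=1$ of $z\mapsto(4\pi^2k^2)^{z/2}$ evaluated at $z=\alpha(x_i)$, and dropping the $k=0$ term (which is zero). The ''direct method'' treats the operator pointwise as a constant-order operator: the $\hat u_k$ are computed once by the fast Fourier transform (FFT) and stored; then, for each $i$ separately, the $N$ numbers $(4\pi^2k^2)^{\alpha(x_i)/2}\hat u_k$, $k\in\mathbb N_N$, are formed, an inverse FFT of length $N$ is applied to them, and the entry of the result at $x_i$ is taken. ''Operations'' are elementary operations on complex numbers (arithmetic operations and evaluations of elementary functions such as powers, exponentials and logarithms each counted as one operation). The FFT and inverse FFT compute a discrete Fourier transform, respectively inverse transform, of length $N$ in $O(N\ln N)$ operations. The implied constants may depend on $m$ and $\mu$ but not on $N$, $u$ or $\alpha$. *)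

(* Defs.v *)
From HB Require Import structures.
From mathcomp Require Import all_boot all_order all_algebra.
From mathcomp Require Import complex.
From mathcomp Require Import all_classical all_reals all_analysis.

Set Implicit Arguments.
Unset Strict Implicit.
Unset Printing Implicit Defensive.

Import Order.TTheory GRing.Theory Num.Theory.
Import numFieldNormedType.Exports.

Local Open Scope classical_set_scope.
Local Open Scope ring_scope.
Local Open Scope complex_scope.

(** * Special functions *)

Section Functions.
Variable R : realType.
Implicit Types (z w : R[i]) (t x : R).

Definition Gamma x : R :=
  (\int[lebesgue_measure]_(t in `]0%R, +oo[) (t `^ (x - 1) * expR (- t)))%R.

Definition cexp z : R[i] :=
  (expR (complex.Re z) * cos (complex.Im z)) +i*
  (expR (complex.Re z) * sin (complex.Im z)).

Definition cmod z : R := Num.sqrt (complex.Re z ^+ 2 + complex.Im z ^+ 2).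

(* Principal argument, in ]-pi, pi]; only meaningful for z != 0. *)
Definition carg z : R :=
  if 0 <= complex.Im z then acos (complex.Re z / cmod z)
  else - acos (complex.Re z / cmod z).

Definition clog z : R[i] := ln (cmod z) +i* carg z.

Definition e2ipi t : R[i] := cexp (0 +i* (2 * pi * t)).

(* The discrete Fourier transform is normalized as the coefficients \hat u_k,
   so that its inverse is the plain sum. Frequencies are in the usual FFT
   order: entry j stands for every k congruent to j modulo n. *)
Definition dft (n : nat) (v : seq R[i]) : seq R[i] :=
  mkseq (fun j => n%:R^-1 *
    \sum_(0 <= l < n) v`_l * e2ipi (- (j%:R * l%:R / n%:R))) n.

Definition idft (n : nat) (v : seq R[i]) : seq R[i] :=
  mkseq (fun l => \sum_(0 <= j < n) v`_j * e2ipi (j%:R * l%:R / n%:R)) n.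

End Functions.

(** * Model of computation *)

(* Straight-line programs over a write-once memory of complex numbers, whose
   cells are numbered in the order in which they are written; the input
   occupies the first cells. The only literals are the integers, pi and i:
   any other constant has to be computed. *)
Inductive expr : Type :=
| Cell of nat
| Int of int
| Pi
| Imag
| Add of expr & expr
| Sub of expr & expr
| Mul of expr & expr
| Div of expr & expr
| Exp of expr
| Log of expr
| Pow of expr & expr.

(* Reading a cell is free; everything else, literals included, costs one. *)
Fixpoint expr_cost (e : expr) : nat :=
  match e with
  | Cell _ => 0
  | Int _ | Pi | Imag => 1
  | Exp a | Log a => (expr_cost a).+1
  | Add a b | Sub a b | Mul a b | Div a b | Pow a b =>
      (expr_cost a + expr_cost b).+1
  end.

(* A routine uses elementary operations only: each expression of its body is
   evaluated and written to the next cell. *)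
Record routine := Routine { body : seq expr; result : seq nat }.

Definition routine_cost (p : routine) : nat := sumn (map expr_cost (body p)).

(* [Fft a] and [Ifft a] apply a given routine to the contents of the cells
   listed in [a], and write its result to the next cells. *)
Inductive instr : Type :=
| Store of expr
| Fft of seq nat
| Ifft of seq nat.

Record program := Program { instrs : seq instr; output : seq nat }.

Section Semantics.
Variable R : realType.
Local Notation memory := (seq R[i]).
Implicit Type m : memory.

(* [None] is an undefined operation: division by 0, log 0, or 0 to a power
   with non-positive real part. *)
Definition cdiv (z w : R[i]) : option R[i] :=
  if w == 0 then None else Some (z / w).

Definition olog (z : R[i]) : option R[i] :=
  if z == 0 then None else Some (clog z).

Definition cpow (z w : R[i]) : option R[i] :=
  if z == 0 then if 0 < complex.Re w then Some 0 else None
  else Some (cexp (w * clog z)).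

Definition lift2 (f : R[i] -> R[i] -> option R[i]) (x y : option R[i]) :=
  obind (fun a => obind (f a) y) x.

Fixpoint expr_eval m (e : expr) : option R[i] :=
  match e with
  | Cell a => onth m a
  | Int k => Some k%:~R
  | Pi => Some (pi : R)%:C
  | Imag => Some (0 +i* 1)
  | Add a b => lift2 (fun z w => Some (z + w)) (expr_eval m a) (expr_eval m b)
  | Sub a b => lift2 (fun z w => Some (z - w)) (expr_eval m a) (expr_eval m b)
  | Mul a b => lift2 (fun z w => Some (z * w)) (expr_eval m a) (expr_eval m b)
  | Div a b => lift2 cdiv (expr_eval m a) (expr_eval m b)
  | Exp a => omap (@cexp R) (expr_eval m a)
  | Log a => obind olog (expr_eval m a)
  | Pow a b => lift2 cpow (expr_eval m a) (expr_eval m b)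
  end.

Fixpoint load m (a : seq nat) : option (seq R[i]) :=
  if a is i :: a' then
    obind (fun z => omap (cons z) (load m a')) (onth m i)
  else Some [::].

Fixpoint exec_body m (c : seq expr) : option memory :=
  if c is e :: c' then
    obind (fun z => exec_body (rcons m z) c') (expr_eval m e)
  else Some m.

Definition run_routine (p : routine) (v : seq R[i]) : option (seq R[i]) :=
  obind (fun m => load m (result p)) (exec_body v (body p)).

Section Programs.
Variables fft ifft : nat -> routine.

Definition exec_instr m (c : instr) : option memory :=
  match c with
  | Store e => omap (rcons m) (expr_eval m e)
  | Fft a => omap (cat m) (obind (run_routine (fft (size a))) (load m a))
  | Ifft a => omap (cat m) (obind (run_routine (ifft (size a))) (load m a))
  end.

Fixpoint exec m (c : seq instr) : option memory :=
  if c is i :: c' then obind (fun m' => exec m' c') (exec_instr m i)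
  else Some m.

Definition run (p : program) (v : seq R[i]) : option (seq R[i]) :=
  obind (fun m => load m (output p)) (exec v (instrs p)).

End Programs.

End Semantics.

Definition instr_cost (fft ifft : nat -> routine) (c : instr) : nat :=
  match c with
  | Store e => expr_cost e
  | Fft a => routine_cost (fft (size a))
  | Ifft a => routine_cost (ifft (size a))
  end.

Definition cost (fft ifft : nat -> routine) (p : program) : nat :=
  sumn (map (instr_cost fft ifft) (instrs p)).

(* N tends to infinity through the even integers *)
Notation even_oo := (within [set N : nat | ~~ odd N] \oo).

Definition even_bigO (R : realType) (f : nat -> nat) (g : nat -> R) : Prop :=
  (fun N => (f N)%:R : R^o) =O_even_oo (g : nat -> R^o).

(* [tr] is [dft R] or [idft R]. *)
Definition is_fast_transform (R : realType)
    (tr : nat -> seq R[i] -> seq R[i]) (p : nat -> routine) : Prop :=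
  (forall (N : nat) (v : seq R[i]), (0 < N)%N -> ~~ odd N -> size v = N ->
     run_routine (p N) v = Some (tr N v)) /\
  even_bigO (fun N => routine_cost (p N)) (fun N => N%:R * ln N%:R : R).

(** * The two schemes *)

Section Schemes.
Variable R : realType.
Implicit Types (u : R -> R[i]) (alpha : R -> R) (mu : R) (N i : nat).

Definition grid N i : R := i%:R * N%:R^-1.

Definition modes N : seq int := [seq j%:Z - (N./2)%:Z | j <- iota 0 N].

Definition coef N u (k : int) : R[i] :=
  N%:R^-1 * \sum_(0 <= i < N) u (grid N i) * e2ipi (- (k%:~R * grid N i)).

Definition symbol (k : int) : R := 4 * pi ^+ 2 * k%:~R ^+ 2.

Definition taylor_degree mu N : nat :=
  `|Num.ceil (expR (mu + 1) * ln (pi * N%:R) - 1)|%N.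

Definition fast_laplacian mu N u alpha i : R[i] :=
  \sum_(0 <= s < (taylor_degree mu N).+1)
    ((alpha (grid N i) - 1) ^+ s)%:C *
    \sum_(k <- modes N | k != 0)
      (symbol k `^ (1 / 2) / Gamma (s%:R + 1) *
       (ln (symbol k) ^+ s / 2 ^+ s))%:C *
      coef N u k * e2ipi (k%:~R * grid N i).

Definition direct_laplacian N u alpha i : R[i] :=
  \sum_(k <- modes N)
    (symbol k `^ (alpha (grid N i) / 2))%:C *
    coef N u k * e2ipi (k%:~R * grid N i).

Definition input N u alpha : seq R[i] :=
  mkseq (fun i => u (grid N i)) N ++
  mkseq (fun i => (alpha (grid N i))%:C) N.

(* [p N] maps the sampled data to [val N u alpha i], 0 <= i < N. *)
Definition computes (fft ifft : nat -> routine) (p : nat -> program)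
    (val : nat -> (R -> R[i]) -> (R -> R) -> nat -> R[i]) : Prop :=
  forall N u alpha, (0 < N)%N -> ~~ odd N ->
    (forall i, (i < N)%N -> 0 < alpha (grid N i) <= 2) ->
    run fft ifft (p N) (input N u alpha) = Some (mkseq (val N u alpha) N).

End Schemes.

(* The element of {-N/2, ..., N/2 - 1} that entry j of a transform of even
   length N stands for. *)
Definition fft_mode (N j : nat) : int :=
  if (j < N./2)%N then j%:Z else j%:Z - N%:Z.

(* Memory layout: u in cells [0, N), alpha in [N, 2N), \hat u in [2N, 3N);
   then, for each i, a block of 2N cells: the N products
   (4 pi^2 k^2)^(alpha(x_i)/2) \hat u_k, and their inverse transform, of which
   only entry i is output. *)
Definition direct_block (N i : nat) : nat := 3 * N + i * (2 * N).

Definition direct_product (N i j : nat) : expr :=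
  let k := Int (fft_mode N j) in
  Mul (Pow (Mul (Mul (Int 4) (Mul Pi Pi)) (Mul k k))
           (Div (Cell (N + i)) (Int 2)))
      (Cell (2 * N + j)).

Definition direct_method (N : nat) : program :=
  Program
    (Fft (iota 0 N) ::
     flatten [seq rcons [seq Store (direct_product N i j) | j <- iota 0 N]
                        (Ifft (iota (direct_block N i) N))
             | i <- iota 0 N])
    [seq (direct_block N i + N + i)%N | i <- iota 0 N].

(* Main.v *)
Require Import Defs.
From mathcomp Require Import all_boot all_order all_algebra.
From mathcomp Require Import complex.
From mathcomp Require Import all_classical all_reals all_analysis.
From mathcomp Require Import measurable_realfun zify ring lra.

Import Order.TTheory GRing.Theory Num.Theory.
Import numFieldNormedType.Exports.

Local Open Scope ring_scope.

(** Both programs have the same shape: one forward transform, then a number [T]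
of blocks, each of which forms [N] products of an explicit multiplier with the
coefficients \hat u_k and applies one inverse transform to them.

In the direct method there is one block per grid point, so [T = N], with
multiplier (4 pi^2 k^2)^(alpha(x_i)/2). In the fast scheme there is one block
per Taylor index [s], since the inner sum over k does not depend on alpha and
one inverse transform yields it at all grid points at once; here
[T = S + 1 = O(ln N)]. The fast scheme then combines, at each grid point, the
[T] results into a polynomial in alpha(x_i) - 1, by Horner's rule.

A block costs [O(N + N ln N)], and the Horner evaluations [O(N T)]. Hence the
totals are [O(N^2 ln N)] and [O(N ln^2 N)]. Correctness of both programs is a
single statement about the common part, [exec_dft_spectral_blocks]. It rests on
two facts: the frequencies in transform order are a rearrangement of
{-N/2, ..., N/2 - 1} modulo N ([perm_modes], [e2ipi_fft_mode]), and elementary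
operations applied to positive reals give the real values. The multipliers of
the fast scheme use integer constants for Gamma(s + 1) = s!, which is proved
from the integral definition ([Gamma_natS]). *)

(** * Gamma at positive integers *)

Section Gamma.
Variable R : realType.
Local Open Scope classical_set_scope.
Implicit Types (x t : R) (n s : nat).

(** The antiderivative of t^n e^(-t) that vanishes at infinity, as given by
    repeated integration by parts. *)
Fixpoint Gamma_primitive n t : R :=
  - (t ^+ n * expR (- t)) + (if n is n'.+1 then n%:R * Gamma_primitive n' t else 0).

Lemma is_derive_Gamma_primitive n t :
  is_derive t 1 (Gamma_primitive n) (t ^+ n * expR (- t)).
Proof.
have dX k : is_derive t 1 (fun t : R => - (t ^+ k * expR (- t)))
    (t ^+ k * expR (- t) - (k%:R * t ^+ k.-1) * expR (- t)).
  have -> : (fun t : R => - (t ^+ k * expR (- t))) =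
            - ((id : R -> R) ^+ k * (expR \o -%R)).
    by apply/funext => x; rewrite /= !fctE.
  have := @is_deriveN _ _ _ _ _ _ _ (is_deriveM (is_deriveX k (is_derive_id t 1))
    (is_derive1_comp (is_derive_expR (- t)) (is_deriveN (is_derive_id t 1)))).
  move=> h; apply: (is_derive_eq h).
  rewrite /= /GRing.scale /= mulr1 mulrN1 mulrN opprD opprK fctE.
  by congr (_ - _); rewrite mulrC.
elim: n => [|n IHn] /=.
  have := is_deriveD (dX 0) (is_derive_cst (0 : R) t 1).
  move=> h; apply: (is_derive_eq h).
  by rewrite mul0r mul0r subr0 addr0.
have := is_deriveD (dX n.+1) (is_deriveZ n.+1%:R IHn).
move=> h; apply: (is_derive_eq h).
by rewrite /= /GRing.scale /= mulrA subrK.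
Qed.

Lemma cvg_Xn_expN n : t ^+ n * expR (- t) @[t --> +oo] --> (0 : R).
Proof.
apply/cvgrPdist_le => e e0; near=> t.
have t0 : 0 < t by near: t; apply: nbhs_pinfty_gt; exact: num_real.
rewrite sub0r normrN ger0_norm; last by rewrite mulr_ge0 ?exprn_ge0 ?expR_ge0// ltW.
rewrite expRN ler_pdivrMr ?expR_gt0//.
have := expR_ge1Dxn n (ltW t0).
have te : n.+1`!%:R / e <= t.
  by near: t; apply: nbhs_pinfty_ge; exact: num_real.
move=> le1; have: t ^+ n.+1 / n.+1`!%:R <= expR t.
  by apply: le_trans le1; rewrite lerDr.
(* For t >= (n+1)! / e, already e t^(n+1) / (n+1)! is at least t^n. *)
rewrite -(ler_pM2l e0); apply: le_trans.
rewrite (_ : e * _ = e * t / n.+1`!%:R * t ^+ n); last by rewrite exprS; ring.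
rewrite ler_peMl ?exprn_ge0 ?(ltW t0)// ler_pdivlMr ?ltr0n ?fact_gt0// mul1r.
by rewrite mulrC -ler_pdivrMr.
Unshelve. all: by end_near. Qed.

Lemma Gamma_primitive_cvgy n : Gamma_primitive n t @[t --> +oo] --> (0 : R).
Proof.
elim: n => [|n IHn] /=.
  rewrite -[X in _ --> X]addr0 -[X in _ --> X + _]oppr0.
  by apply: cvgD (cvg_cst _); apply: cvgN; exact: cvg_Xn_expN.
rewrite -[X in _ --> X]addr0 -[X in _ --> X + _]oppr0.
rewrite -[X in _ --> _ + X](mulr0 n.+1%:R).
by apply: cvgD; [apply: cvgN; exact: cvg_Xn_expN | exact: cvgMr].
Qed.

Lemma Gamma_primitive0 n : Gamma_primitive n 0 = - n`!%:R.
Proof.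
elim: n => [|n IHn] /=; first by rewrite expr0 oppr0 expR0 mul1r addr0.
by rewrite expr0n mul0r oppr0 add0r IHn mulrN factS natrM.
Qed.

Lemma Gamma_natS n : Gamma (n%:R + 1) = n`!%:R :> R.
Proof.
have dP t := is_derive_Gamma_primitive n t.
have cP t : {for t, continuous (Gamma_primitive n)}.
  exact/differentiable_continuous/derivable1_diffP/(@ex_derive _ _ _ _ _ _ _ (dP t)).
have cf : continuous (fun t : R => t ^+ n * expR (- t)).
  move=> t; apply: cvgM; first exact: exprn_continuous.
  exact: (continuous_comp (@oppr_continuous _ _ t) (@continuous_expR _ _)).
rewrite /Gamma.
transitivity (\int[@lebesgue_measure R]_(t in `]0%R, +oo[) (t ^+ n * expR (- t)))%R.
  apply: eq_Rintegral => t; rewrite inE/= in_itv/= andbT => t0.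
  by rewrite addrK powR_mulrn// ltW.
rewrite /Rintegral.
rewrite integral_itv_obnd_cbnd; last first.
  apply/measurable_EFinP; apply: measurable_funTS.
  exact: continuous_measurable_fun cf.
rewrite (@ge0_continuous_FTC2y _ _ (Gamma_primitive n) 0 0).
- by rewrite Gamma_primitive0 /= opprK add0r.
- by move=> x x0; rewrite mulr_ge0 ?exprn_ge0 ?expR_ge0.
- exact: continuous_subspaceT.
- exact: Gamma_primitive_cvgy.
- by move=> x _; exact: (@ex_derive _ _ _ _ _ _ _ (dP x)).
- exact/cvg_at_right_filter/cP.
- by move=> x _; rewrite derive1E (@derive_val _ _ _ _ _ _ _ (dP x)).
Qed.

End Gamma.

(** * Execution of programs *)

Section Cells.
Variable T : Type.
Implicit Types (m v : seq T) (f : nat -> T).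

Lemma onth_mkseq f n i : (i < n)%N -> onth (mkseq f n) i = Some (f i).
Proof.
by move=> lt_i_n; rewrite onth_map onthE (nth_map 0%N) ?size_iota// nth_iota.
Qed.

Lemma onth_catl m v i z : onth m i = Some z -> onth (m ++ v) i = Some z.
Proof.
move=> miz; rewrite onth_cat; case: ltnP => // le_m_i.
by rewrite onth_default in miz.
Qed.

Lemma onth_catr m v i z n :
  size m = n -> onth v i = Some z -> onth (m ++ v) (n + i)%N = Some z.
Proof. by move=> <- viz; rewrite onth_cat ltnNge leq_addr addKn. Qed.

Lemma onth_flatten_const n (g : nat -> seq T) (k t i : nat) (z : T) :
    (forall j, size (g j) = n) -> (t < k)%N -> onth (g t) i = Some z ->
  onth (flatten [seq g j | j <- iota 0 k]) (t * n + i) = Some z.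
Proof.
move=> size_g lt_t_k giz.
rewrite -(subnKC lt_t_k) -addn1 -addnA iotaD map_cat flatten_cat add0n.
apply: onth_catr.
  rewrite size_flatten /shape -map_comp sumnE big_map.
  rewrite (eq_bigr (fun=> n)) => [|j _]; last exact: size_g.
  by rewrite big_const_seq count_predT size_iota iter_addn_0 mulnC.
rewrite add1n /=; exact: onth_catl.
Qed.

End Cells.

Section Execution.
Variable R : realType.
Implicit Types (m v : seq R[i]) (z : R[i]).

(** Memory is write-once, so that a value, once computable, remains so. *)
Lemma expr_eval_cat m v (e : expr) z :
  expr_eval m e = Some z -> expr_eval (m ++ v) e = Some z.
Proof.
elim: e z => //=; do ?[by move=> *; exact: onth_catl];
  try by move=> a IHa b IHb z; case: (expr_eval m a) IHa => // x /(_ _ erefl) ->;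
    case: (expr_eval m b) IHb => // y /(_ _ erefl) ->.
all: by move=> a IHa z; case: (expr_eval m a) IHa => // x /(_ _ erefl) ->.
Qed.

Lemma load_map (I : eqType) m (s : seq I) (a : I -> nat) (f : I -> R[i]) :
    {in s, forall i, onth m (a i) = Some (f i)} ->
  load m (map a s) = Some (map f s).
Proof.
elim: s => //= i s IHs mP; rewrite mP ?mem_head//= IHs// => j sj.
by apply: mP; rewrite inE sj orbT.
Qed.

Lemma load_cat m v w n : size m = n -> load (m ++ v ++ w) (iota n (size v)) = Some v.
Proof.
move=> size_m; case: v => // x0 v'; set v := x0 :: v'.
rewrite -[in RHS](mkseq_nth x0 v) -[n]addn0 iotaDl; apply: load_map => i.
rewrite mem_iota => /andP[_ lt_i_v].
apply: onth_catr => //; apply: onth_catl.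
by rewrite onthE (nth_map x0).
Qed.

Variables fft ifft : nat -> routine.
Local Notation exec := (@exec R fft ifft).

Lemma exec_cat m c d : exec m (c ++ d) = obind (fun m' => exec m' d) (exec m c).
Proof.
elim: c m => //= i c IHc m.
by case: exec_instr => //= m'; rewrite IHc.
Qed.

Lemma exec_store (I : eqType) m (s : seq I) (a : I -> expr) (f : I -> R[i]) :
    {in s, forall i, expr_eval m (a i) = Some (f i)} ->
  exec m [seq Store (a i) | i <- s] = Some (m ++ map f s).
Proof.
elim: s m => [|i s IHs] m mP /=; first by rewrite cats0.
rewrite mP ?mem_head//= IHs ?cat_rcons// => j sj.
by rewrite -cats1; apply/expr_eval_cat/mP; rewrite inE sj orbT.
Qed.

Hypothesis ifftP : forall (N : nat) v, (0 < N)%N -> ~~ odd N -> size v = N ->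
  run_routine (ifft N) v = Some (idft N v).

(** [T] blocks of [2 N] cells, laid out as in the direct method: block [t]
    holds the values of the expressions [e t j], [j < N], followed by their
    inverse transform. *)
Definition spectral_blocks N T (e : nat -> nat -> expr) : seq instr :=
  flatten [seq rcons [seq Store (e t j) | j <- iota 0 N]
                     (Ifft (iota (direct_block N t) N))
          | t <- iota 0 T].

(** The expressions may only depend on the [3 N] cells that precede the
    blocks: the samples of u and alpha, and the coefficients of u. *)
Lemma exec_spectral_blocks N T e (f : nat -> nat -> R[i]) m :
    (0 < N)%N -> ~~ odd N -> size m = (3 * N)%N ->
    (forall t j, (t < T)%N -> (j < N)%N -> expr_eval m (e t j) = Some (f t j)) ->
  exec m (spectral_blocks N T e) =
    Some (m ++ flatten [seq mkseq (f t) N ++ idft N (mkseq (f t) N)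
                       | t <- iota 0 T]).
Proof.
move=> N_gt0 N_even size_m.
rewrite /spectral_blocks; elim: T => [_|T IHT mP]; first by rewrite cats0.
rewrite -addn1 iotaD !map_cat !flatten_cat exec_cat IHT => [|t j ltT ltN]; last first.
  by apply: mP => //; exact: ltnW.
rewrite add0n /= !cats0 -cats1 exec_cat.
set fl := flatten _.
have size_fl : size (m ++ fl) = direct_block N T.
  rewrite size_cat size_flatten /shape -map_comp sumnE big_map size_m.
  rewrite (eq_bigr (fun=> 2 * N)%N) => [|i _]; last first.
    by rewrite /= size_cat !size_mkseq mul2n addnn.
  by rewrite big_const_seq count_predT size_iota iter_addn_0 mulnC /direct_block; lia.
rewrite (@exec_store _ _ _ (e T) (f T)) => [|j]; last first.
  rewrite mem_iota => /andP[_ ltjN].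
  by apply: expr_eval_cat; exact: mP.
have := @load_cat (m ++ fl) (mkseq (f T) N) [::] _ size_fl.
rewrite /= size_iota cats0 size_mkseq => -> /=.
by rewrite ifftP ?size_mkseq //= !catA.
Qed.

End Execution.

(** * Elementary functions on the reals *)

Section ComplexFunctions.
Variable R : realType.
Local Open Scope complex_scope.
Implicit Types (a x t : R) (n : nat) (k : int).

Lemma cexp_real x : cexp x%:C = (expR x)%:C.
Proof. by rewrite /cexp /= cos0 sin0 mulr1 mulr0. Qed.

Lemma clog_real a : 0 < a -> clog a%:C = (ln a)%:C.
Proof.
move=> a_gt0; have cmodE : cmod a%:C = a.
  by rewrite /cmod /= expr0n addr0 sqrtr_sqr gtr0_norm.
by rewrite /clog /carg cmodE /= lexx divff ?gt_eqF// acos1.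
Qed.

Lemma cpow_real a x : 0 < a -> cpow a%:C x%:C = Some (a `^ x)%:C.
Proof.
move=> a_gt0; have a_neq0 : a != 0 by rewrite gt_eqF.
rewrite /cpow fmorph_eq0 (negPf a_neq0) clog_real// -rmorphM cexp_real.
by rewrite /powR (negPf a_neq0).
Qed.

Lemma cpow0 x : 0 < x -> cpow 0 x%:C = Some 0.
Proof. by move=> x_gt0; rewrite /cpow eqxx /= x_gt0. Qed.

Lemma olog_real a : 0 < a -> olog a%:C = Some (ln a)%:C.
Proof. by move=> a_gt0; rewrite /olog fmorph_eq0 gt_eqF// clog_real. Qed.

Lemma cdiv_real x a : a != 0 -> cdiv x%:C a%:C = Some (x / a)%:C.
Proof.
by move=> a_neq0; rewrite /cdiv fmorph_eq0 (negPf a_neq0) -fmorphV -rmorphM.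
Qed.

Lemma e2ipiDn t n : e2ipi (t + n%:R) = e2ipi t.
Proof.
rewrite /e2ipi /cexp /= mulrDr.
have -> : 2 * pi * n%:R = pi *+ 2 *+ n :> R by rewrite -[RHS]mulr_natr -[pi *+ 2]mulr_natl.
by rewrite (periodicn (@cosD2pi R)) (periodicn (@sinD2pi R)).
Qed.

Lemma e2ipiBn t n : e2ipi (t - n%:R) = e2ipi t.
Proof. by rewrite -(e2ipiDn _ n) subrK. Qed.

End ComplexFunctions.

(** * Frequencies *)

Section Modes.
Variable R : realType.
Local Open Scope complex_scope.
Implicit Types (N j l : nat) (k : int).

(** The transform order starts with the nonnegative frequencies, the
    increasing order with the negative ones: each is the other with its two
    halves exchanged. *)
Lemma perm_modes N : ~~ odd N -> perm_eq (modes N) (map (fft_mode N) (iota 0 N)).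
Proof.
move=> N_even; set h := N./2.
have hN : N = (h + h)%N by rewrite addnn -[LHS]odd_double_half (negPf N_even).
rewrite /modes [in iota 0 N]hN iotaD !map_cat perm_catC add0n.
have iota_h : iota h h = map (addn h) (iota 0 h) by rewrite -iotaDl addn0.
rewrite iota_h -!map_comp; apply/permP => x; rewrite !count_cat; congr (_ + _)%N.
  congr (count _ _); apply/eq_in_map => i; rewrite mem_iota => /andP[_ i_lt].
  by rewrite /= /fft_mode -/h i_lt; lia.
congr (count _ _); apply/eq_in_map => i; rewrite mem_iota => /andP[_ i_lt].
by rewrite /= /fft_mode -/h ltnNge leq_addr /=; lia.
Qed.

(** Shifting a frequency by N is invisible on the grid. *)
Lemma e2ipi_fft_mode N j l : (0 < N)%N ->
  e2ipi ((fft_mode N j)%:~R * grid R N l) = e2ipi (j%:R * l%:R / N%:R).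
Proof.
move=> N_gt0; rewrite /fft_mode /grid; case: ifP => _; first by rewrite mulrA.
rewrite intrB mulrBl mulrA -[RHS](e2ipiBn _ _ l); congr (e2ipi (_ - _)).
by rewrite -pmulrn mulrCA divff ?mulr1// pnatr_eq0 -lt0n.
Qed.

Lemma e2ipi_fft_modeN N j l : (0 < N)%N ->
  e2ipi (- ((fft_mode N j)%:~R * grid R N l)) = e2ipi (- (j%:R * l%:R / N%:R)).
Proof.
move=> N_gt0; rewrite /fft_mode /grid; case: ifP => _; first by rewrite mulrA.
rewrite intrB mulrBl opprB mulrA addrC -[RHS](e2ipiDn _ _ l); congr (e2ipi (_ + _)).
  by rewrite mulrA.
by rewrite -pmulrn mulrAC divff ?mul1r// pnatr_eq0 -lt0n.
Qed.

Lemma dft_coef N (u : R -> R[i]) : (0 < N)%N ->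
  dft N (mkseq (fun i => u (grid R N i)) N) =
  mkseq (fun j => coef N u (fft_mode N j)) N.
Proof.
move=> N_gt0; apply: eq_mkseq => j; rewrite /coef; congr (_ * _).
apply: eq_big_nat => l /andP[_ l_lt].
by rewrite e2ipi_fft_modeN// nth_mkseq.
Qed.

Lemma onth_idft_modes N (F : int -> R[i]) l : (0 < N)%N -> ~~ odd N -> (l < N)%N ->
  onth (idft N (mkseq (fun j => F (fft_mode N j)) N)) l =
  Some (\sum_(k <- modes N) F k * e2ipi (k%:~R * grid R N l)).
Proof.
move=> N_gt0 N_even l_lt; rewrite onth_mkseq//; congr Some.
rewrite (perm_big _ (perm_modes _ N_even)) big_map.
rewrite -[X in iota 0 X]subn0; apply: eq_big_nat => j /andP[_ j_lt].
by rewrite e2ipi_fft_mode// nth_mkseq.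
Qed.

(** The expression 4 pi^2 k^2, for a frequency [k] known in advance. *)
Definition symbol_expr k : expr :=
  Mul (Mul (Int 4) (Mul Pi Pi)) (Mul (Int k) (Int k)).

Lemma expr_eval_symbol (m : seq R[i]) k :
  expr_eval m (symbol_expr k) = Some (symbol R k)%:C.
Proof.
rewrite /= /symbol !rmorphM !rmorph_int /= -!expr2; congr Some.
by rewrite -!mulrA -(rmorph_int (real_complex R) 4).
Qed.

Lemma symbol0 : symbol R 0 = 0.
Proof. by rewrite /symbol expr0n mulr0. Qed.

(** Hence the logarithm of the symbol is positive, and its powers can be
    computed by [Pow], even with exponent 0. *)
Lemma symbol_gt1 k : k != 0 -> 1 < symbol R k.
Proof.
move=> k_neq0; have k2 : 1 <= k%:~R ^+ 2 :> R.
  by rewrite -rmorphXn /= -[1]/(1%:~R) ler_int; lia.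
have pi2 : 4 <= pi ^+ 2 :> R by have := pi_ge2 R; nra.
rewrite /symbol; nra.
Qed.

End Modes.

(** * The two programs *)

Section Evaluation.
Variable R : realType.
Local Open Scope complex_scope.
Implicit Types (m : seq R[i]) (a b : expr) (z w : R[i]).

Lemma expr_eval_Int {m} k : expr_eval m (Int k) = Some (k%:~R : R)%:C.
Proof. by rewrite rmorph_int. Qed.

Lemma expr_eval_Mul {m a b z w} :
    expr_eval m a = Some z -> expr_eval m b = Some w ->
  expr_eval m (Mul a b) = Some (z * w).
Proof. by move=> /= -> ->. Qed.

Lemma expr_eval_Div {m a b z w q} :
    expr_eval m a = Some z -> expr_eval m b = Some w -> cdiv z w = Some q ->
  expr_eval m (Div a b) = Some q.
Proof. by move=> /= -> ->. Qed.

Lemma expr_eval_Pow {m a b z w q} :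
    expr_eval m a = Some z -> expr_eval m b = Some w -> cpow z w = Some q ->
  expr_eval m (Pow a b) = Some q.
Proof. by move=> /= -> ->. Qed.

Lemma expr_eval_Log {m a z w} :
    expr_eval m a = Some z -> olog z = Some w -> expr_eval m (Log a) = Some w.
Proof. by move=> /= ->. Qed.

End Evaluation.
Arguments expr_eval_Int {R m} k.
Arguments expr_eval_Mul {R m a b z w}.
Arguments expr_eval_Div {R m a b z w q}.
Arguments expr_eval_Pow {R m a b z w q}.
Arguments expr_eval_Log {R m a z w}.

(** The multiplier of mode [k] in the Taylor term of index [s]. The integer
    s! 2^s stands for Gamma(s + 1) 2^s. The zero mode is given weight 0, which
    removes it from the sum. *)
Definition fast_weight (s : nat) (k : int) : expr :=
  if k == 0 then Int 0 else
  Div (Mul (Pow (symbol_expr k) (Div (Int 1) (Int 2)))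
           (Pow (Log (symbol_expr k)) (Int s)))
      (Int (s`! * 2 ^ s)%N).

Definition fast_product N s j : expr :=
  Mul (fast_weight s (fft_mode N j)) (Cell (2 * N + j)).

(** Horner's rule at [x], for coefficients stored in the cells [a], in order
    of increasing degree. *)
Fixpoint horner_expr (x : expr) (a : seq nat) : expr :=
  if a is i :: a' then Add (Cell i) (Mul x (horner_expr x a')) else Int 0.

(** The value of the fast scheme at x_i: the coefficient of degree [s] is
    entry [i] of the inverse transform in block [s]. *)
Definition fast_sum N T i : expr :=
  horner_expr (Defs.Sub (Cell (N + i)) (Int 1))
    [seq (direct_block N s + N + i)%N | s <- iota 0 T].

(** The fast scheme: the common part with [S + 1] blocks, followed by the
    [N] Horner evaluations, which are the output. *)
Definition fast_method (R : realType) (mu : R) N : program :=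
  let T := (taylor_degree mu N).+1 in
  Program
    ((Fft (iota 0 N) :: spectral_blocks N T (fast_product N)) ++
     [seq Store (fast_sum N T i) | i <- iota 0 N])
    (iota (direct_block N T) N).

Section Correctness.
Variables (R : realType) (fft ifft : nat -> routine).
Local Open Scope complex_scope.
Hypothesis fftP : forall N (v : seq R[i]), (0 < N)%N -> ~~ odd N -> size v = N ->
  run_routine (fft N) v = Some (dft N v).
Hypothesis ifftP : forall N (v : seq R[i]), (0 < N)%N -> ~~ odd N -> size v = N ->
  run_routine (ifft N) v = Some (idft N v).

(** The common part of the two programs: if block [t] forms the products of
    the multipliers [c t k] with the coefficients of u, then the second half of
    that block contains the corresponding trigonometric sum at every grid
    point. *)
Lemma exec_dft_spectral_blocks N T (e : nat -> nat -> expr) (c : nat -> int -> R[i])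
    (u : R -> R[i]) (alpha : R -> R) :
    (0 < N)%N -> ~~ odd N ->
    (forall m t j, (t < T)%N -> (j < N)%N ->
       (forall i, (i < N)%N -> onth m (N + i) = Some (alpha (grid R N i))%:C) ->
       onth m (2 * N + j) = Some (coef N u (fft_mode N j)) ->
       expr_eval m (e t j) = Some (c t (fft_mode N j) * coef N u (fft_mode N j))) ->
  exists M : seq R[i],
    [/\ exec fft ifft (input N u alpha) (Fft (iota 0 N) :: spectral_blocks N T e)
          = Some M,
        size M = direct_block N T,
        forall i, (i < N)%N -> onth M (N + i) = Some (alpha (grid R N i))%:C &
        forall t i, (t < T)%N -> (i < N)%N ->
          onth M (direct_block N t + N + i) =
          Some (\sum_(k <- modes N) c t k * coef N u k * e2ipi (k%:~R * grid R N i))].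
Proof.
move=> N_gt0 N_even eP.
(* The memory consists of [m0], the first 3N cells, and of the blocks [G t]. *)
set us := mkseq (fun i => u (grid R N i)) N.
set als := mkseq (fun i => (alpha (grid R N i))%:C) N.
set cs := mkseq (fun j => coef N u (fft_mode N j)) N.
pose m0 := (us ++ als) ++ cs.
pose F t k := c t k * coef N u k.
pose G t := mkseq (fun j => F t (fft_mode N j)) N ++
            idft N (mkseq (fun j => F t (fft_mode N j)) N).
have size_in : size (us ++ als) = (2 * N)%N.
  by rewrite size_cat !size_mkseq mul2n addnn.
have size_m0 : size m0 = (3 * N)%N by rewrite size_cat size_in size_mkseq; lia.
have size_G t : size (G t) = (2 * N)%N.
  by rewrite size_cat !size_mkseq mul2n addnn.
have m0_alpha i : (i < N)%N -> onth m0 (N + i) = Some (alpha (grid R N i))%:C.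
  move=> i_lt; apply: onth_catl; apply: onth_catr; first by rewrite size_mkseq.
  by rewrite onth_mkseq.
have m0_coef j : (j < N)%N -> onth m0 (2 * N + j) = Some (coef N u (fft_mode N j)).
  by move=> j_lt; apply: onth_catr; rewrite ?onth_mkseq.
exists (m0 ++ flatten [seq G t | t <- iota 0 T]); split.
- have := @load_cat R [::] us als 0 erefl.
  rewrite size_mkseq /= size_iota => -> /=.
  rewrite fftP ?size_mkseq//= dft_coef// -/cs -/m0.
  apply: (exec_spectral_blocks _ _ _ ifftP _ _ _ (fun t j => F t (fft_mode N j))) => //.
  by move=> t j t_lt j_lt; apply: eP => //; exact: m0_coef.
- rewrite size_cat size_m0 size_flatten /shape -map_comp sumnE big_map.
  rewrite (eq_bigr (fun=> 2 * N)%N) => [|t _]; last exact: size_G.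
  by rewrite big_const_seq count_predT size_iota iter_addn_0 mulnC /direct_block; lia.
- by move=> i i_lt; apply/onth_catl/m0_alpha.
- move=> t i t_lt i_lt; rewrite (_ : _ + i = 3 * N + (t * (2 * N) + (N + i)))%N; last first.
    by rewrite /direct_block; lia.
  apply: onth_catr => //.
  apply: (onth_flatten_const _ (2 * N)%N G) => //; apply: onth_catr; first by rewrite size_mkseq.
  exact: onth_idft_modes.
Qed.

Lemma direct_method_correct : computes fft ifft direct_method (@direct_laplacian R).
Proof.
move=> N u alpha N_gt0 N_even alphaP.
pose c t k : R[i] := (symbol R k `^ (alpha (grid R N t) / 2))%:C.
have [|M [execM _ _ M_out]] :=
    exec_dft_spectral_blocks N N (direct_product N) c u alpha N_gt0 N_even.
  move=> m t j t_lt j_lt m_alpha m_coef.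
  set k := fft_mode N j.
  rewrite -[direct_product N t j]/(Mul (Pow (symbol_expr k)
    (Div (Cell (N + t)) (Int 2))) (Cell (2 * N + j))).
  have /andP[alpha_gt0 _] := alphaP t t_lt.
  apply: expr_eval_Mul => //; apply: expr_eval_Pow (expr_eval_symbol _ _ _) _ _.
    apply: (@expr_eval_Div _ _ _ _ (alpha (grid R N t))%:C);
      [exact: m_alpha | exact: expr_eval_Int |].
    by rewrite cdiv_real.
  (* For k = 0 the power 0^(alpha/2) is defined because alpha is positive. *)
  rewrite /c; have [k0|k_neq0] := eqVneq k 0.
    rewrite k0 symbol0 cpow0 ?divr_gt0// powR0//.
    by rewrite gt_eqF// divr_gt0.
  by rewrite cpow_real// (lt_trans ltr01 (symbol_gt1 _ _ k_neq0)).
rewrite /run execM /=; apply: load_map => i; rewrite mem_iota => /andP[_ i_lt].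
exact: M_out.
Qed.

Lemma expr_eval_fast_weight (m : seq R[i]) s k :
  expr_eval m (fast_weight s k) =
  Some (if k == 0 then 0 else
    (symbol R k `^ (1 / 2) / Gamma (s%:R + 1) * (ln (symbol R k) ^+ s / 2 ^+ s))%:C).
Proof.
rewrite /fast_weight; have [//|k_neq0] := eqVneq k 0.
have sym_gt1 := symbol_gt1 R _ k_neq0.
have sym_gt0 := lt_trans ltr01 sym_gt1.
have f_neq0 : (s`! * 2 ^ s)%:R != 0 :> R.
  by rewrite pnatr_eq0 -lt0n muln_gt0 fact_gt0 expn_gt0.
have powE : expr_eval m (Pow (symbol_expr k) (Div (Int 1) (Int 2))) =
    Some (symbol R k `^ (1 / 2))%:C.
  apply: expr_eval_Pow (expr_eval_symbol _ _ _) _ (cpow_real _ _ _ sym_gt0).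
  by apply: expr_eval_Div (expr_eval_Int 1) (expr_eval_Int 2) _; rewrite cdiv_real.
have logE : expr_eval m (Pow (Log (symbol_expr k)) (Int s)) =
    Some (ln (symbol R k) ^+ s)%:C.
  apply: expr_eval_Pow _ (expr_eval_Int _) _.
    exact: expr_eval_Log (expr_eval_symbol _ _ _) (olog_real _ _ sym_gt0).
  by rewrite cpow_real ?ln_gt0// -pmulrn powR_mulrn// ln_ge0// ltW.
apply: expr_eval_Div (expr_eval_Mul powE logE) (expr_eval_Int _) _.
rewrite -pmulrn -rmorphM cdiv_real//; congr (Some _%:C).
rewrite Gamma_natS natrM natrX invfM; ring.
Qed.

Lemma expr_eval_horner (m : seq R[i]) x (xv : R[i]) (a : nat -> nat) (av : nat -> R[i]) T :
    expr_eval m x = Some xv ->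
    (forall s, (s < T)%N -> onth m (a s) = Some (av s)) ->
  expr_eval m (horner_expr x (map a (iota 0 T))) = Some (\sum_(0 <= s < T) xv ^+ s * av s).
Proof.
move=> xE; elim: T a av => [|T IHT] a av aE; first by rewrite big_geq.
rewrite /= -[1%N]addn0 iotaDl -map_comp xE aE//=.
rewrite (IHT _ (av \o succn)) => [|s s_lt]; last exact: aE.
rewrite big_nat_recl// expr0 mul1r /= mulr_sumr; congr (Some (_ + _)).
by apply: eq_bigr => s _; rewrite exprS mulrA.
Qed.

(** The fast scheme in the form in which it is computed: the zero mode enters
    with weight 0. *)
Lemma fast_laplacianE (mu : R) N u alpha i :
  fast_laplacian mu N u alpha i = \sum_(0 <= s < (taylor_degree mu N).+1)
    (alpha (grid R N i) - 1)%:C ^+ s *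
    \sum_(k <- modes N) (if k == 0 then 0 else
      (symbol R k `^ (1 / 2) / Gamma (s%:R + 1) * (ln (symbol R k) ^+ s / 2 ^+ s))%:C)
      * coef N u k * e2ipi (k%:~R * grid R N i).
Proof.
apply: eq_bigr => s _; rewrite rmorphXn; congr (_ * _).
by rewrite big_mkcond; apply: eq_bigr => k _; case: eqP; rewrite ?mul0r.
Qed.

Lemma fast_method_correct (mu : R) : computes fft ifft (fast_method R mu) (@fast_laplacian R mu).
Proof.
move=> N u alpha N_gt0 N_even alphaP.
set T := (taylor_degree mu N).+1.
pose c s k : R[i] := if k == 0 then 0 else
  (symbol R k `^ (1 / 2) / Gamma (s%:R + 1) * (ln (symbol R k) ^+ s / 2 ^+ s))%:C.
have [|M [execM size_M M_alpha M_out]] :=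
    exec_dft_spectral_blocks N T (fast_product N) c u alpha N_gt0 N_even.
  move=> m s j s_lt j_lt m_alpha m_coef.
  by apply: expr_eval_Mul; [exact: expr_eval_fast_weight | exact: m_coef].
rewrite /run -[instrs _]/((Fft (iota 0 N) :: spectral_blocks N T (fast_product N))
  ++ [seq Store (fast_sum N T i) | i <- iota 0 N]).
rewrite exec_cat execM -[output _]/(iota (direct_block N T) N) [obind _ (Some M)]/=.
rewrite (@exec_store _ _ _ _ _ _ (fast_sum N T) (fast_laplacian mu N u alpha)) => [|i].
  have := @load_cat R M (mkseq (fast_laplacian mu N u alpha) N) [::] _ size_M.
  by rewrite cats0 size_mkseq.
rewrite mem_iota => /andP[_ i_lt].
rewrite fast_laplacianE -/T.
apply: expr_eval_horner => [|s s_lt]; last exact: M_out.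
by rewrite /= M_alpha//= rmorphB rmorph1.
Qed.

End Correctness.

(** * Operation counts *)

Section Cost.
Variables fft ifft : nat -> routine.

Lemma sumn_map_le (I : eqType) (s : seq I) (f : I -> nat) (c : nat) :
  {in s, forall i, f i <= c}%N -> (sumn (map f s) <= size s * c)%N.
Proof.
elim: s => //= i s IHs sP; rewrite mulSn leq_add ?sP ?mem_head// IHs// => j sj.
by rewrite sP// inE sj orbT.
Qed.

Lemma cost_spectral_blocks N T (e : nat -> nat -> expr) (c : nat) :
    (forall t j, expr_cost (e t j) <= c)%N ->
  (sumn (map (instr_cost fft ifft) (spectral_blocks N T e)) <=
   T * (N * c + routine_cost (ifft N)))%N.
Proof.
move=> e_le; rewrite /spectral_blocks map_flatten sumn_flatten -!map_comp.
rewrite -[X in (_ <= X * _)%N](size_iota 0 T); apply: sumn_map_le => t _ /=.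
rewrite map_rcons sumn_rcons /= size_iota leq_add2r -map_comp.
by rewrite -[X in (_ <= X * _)%N](size_iota 0 N); apply: sumn_map_le => j _ /=.
Qed.

Lemma cost_direct_method N :
  (cost fft ifft (direct_method N) <=
   routine_cost (fft N) + N * (N * 13 + routine_cost (ifft N)))%N.
Proof.
rewrite /cost /= size_iota leq_add2l.
exact: (cost_spectral_blocks _ _ (direct_product N)).
Qed.

Lemma cost_fast_product N s j : (expr_cost (fast_product N s j) <= 29)%N.
Proof. by rewrite /fast_product /fast_weight; case: ifP. Qed.

Lemma cost_horner_expr x a :
  expr_cost (horner_expr x a) = (size a * (expr_cost x + 2)).+1.
Proof. by elim: a => //= _ a ->; lia. Qed.

Lemma cost_fast_method (R : realType) (mu : R) N :
  (cost fft ifft (fast_method R mu N) <=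
   routine_cost (fft N) +
   (taylor_degree mu N).+1 * (N * 29 + routine_cost (ifft N)) +
   N * ((taylor_degree mu N).+1 * 4).+1)%N.
Proof.
set T := (taylor_degree mu N).+1.
rewrite /cost -[instrs _]/((Fft (iota 0 N) :: spectral_blocks N T (fast_product N))
  ++ [seq Store (fast_sum N T i) | i <- iota 0 N]) map_cat sumn_cat leq_add//.
  rewrite /= size_iota leq_add2l; apply: cost_spectral_blocks => s j.
  exact: cost_fast_product.
rewrite -map_comp -[X in (_ <= X * _)%N](size_iota 0 N).
by apply: sumn_map_le => i _; rewrite /= cost_horner_expr size_map size_iota.
Qed.

End Cost.

(** * Asymptotics *)

Section Asymptotics.
Variable R : realType.
Local Open Scope classical_set_scope.
Implicit Types (f : nat -> nat) (g : nat -> R) (mu : R) (N : nat).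

Lemma even_bigOP f g :
  even_bigO f g <->
  exists2 C : R, 0 < C & \forall N \near \oo, ~~ odd N -> (f N)%:R <= C * `|g N|.
Proof.
rewrite /even_bigO; split.
  move=> /eqO_exP[C C_gt0 fg]; exists C => //.
  by apply: filterS fg => N; rewrite normr_nat.
move=> [C C_gt0 fg]; apply/eqO_exP; exists C => //.
by apply: filterS fg => N fgN /= /fgN; rewrite normr_nat.
Qed.

Lemma near_ln_ge1 : \forall N \near \oo, 1 <= ln (N%:R : R).
Proof.
near=> N; have le_eN : expR 1 <= N%:R :> R by near: N; exact: nbhs_infty_ger.
rewrite -[leLHS]expRK ler_ln ?posrE ?expR_gt0//.
exact: lt_le_trans (expR_gt0 1) le_eN.
Unshelve. all: by end_near. Qed.

(** S + 1 = O(ln N), with a bound valid as soon as ln N >= 1. *)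
Lemma taylor_degree_le mu : exists2 C : R, 0 <= C &
  forall N, 1 <= ln (N%:R : R) -> (taylor_degree mu N).+1%:R <= C * ln N%:R.
Proof.
set E := expR (mu + 1); have E_gt0 : 0 < E by exact: expR_gt0.
have pi_ge1 : 1 <= pi :> R by have := pi_ge2 R; lra.
have lnpi_ge0 : 0 <= ln (pi : R) by exact: ln_ge0.
exists (E * ln pi + E + 1) => [|N L_ge1]; first by nra.
have N_gt0 : (0 : R) < N%:R.
  by rewrite ltNge; apply/negP => /ln0 lnN; move: L_ge1; rewrite lnN; lra.
rewrite /taylor_degree -/E lnM ?posrE ?pi_gt0//.
set L := ln N%:R in L_ge1 *; set y := E * _ - 1.
have y_gt : - 1 < y by rewrite /y; nra.
have := ceilB1_lt y; rewrite intrB => ceil_lt.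
have ceil_ge0 : 0 <= Num.ceil y by rewrite ceil_ge0.
rewrite -natr1 natr_absz (ger0_norm ceil_ge0).
(* The additive term E ln(pi) is absorbed using L >= 1. *)
have : 0 <= E * ln pi * (L - 1) by rewrite !mulr_ge0 ?subr_ge0// ltW.
by rewrite /y in ceil_lt; lra.
Qed.

(** From some point on ln N >= 1, so that the absolute value can be dropped. *)
Lemma even_bigO_near (p : nat -> nat) :
    even_bigO p (fun N => N%:R * ln N%:R : R) ->
  exists2 C : R, 0 <= C & \forall N \near \oo, ~~ odd N ->
    (p N)%:R <= C * (N%:R * ln N%:R).
Proof.
move=> /even_bigOP[C C_gt0 pO]; exists C; first exact: ltW.
near=> N => N_even.
have -> : N%:R * ln N%:R = `|N%:R * ln (N%:R : R)|.
  rewrite ger0_norm// mulr_ge0// (le_trans ler01)//; near: N; exact: near_ln_ge1.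
by move: N_even; near: N.
Unshelve. all: by end_near. Qed.

Lemma even_bigO_of_le (p : nat -> nat) (G : nat -> R) (C : R) : 0 <= C ->
    (\forall N \near \oo, ~~ odd N -> 0 <= G N /\ (p N)%:R <= C * G N) ->
  even_bigO p G.
Proof.
move=> C_ge0 pG; apply/even_bigOP; exists (C + 1); first by rewrite ltr_wpDl.
near=> N => N_even.
have [G_ge0 p_le] : 0 <= G N /\ (p N)%:R <= C * G N by move: N_even; near: N.
by rewrite ger0_norm// mulrDl (le_trans p_le)// lerDl mul1r.
Unshelve. all: by end_near. Qed.

Variables fft ifft : nat -> routine.
Hypothesis fftO :
  even_bigO (fun N => routine_cost (fft N)) (fun N => N%:R * ln N%:R : R).
Hypothesis ifftO :
  even_bigO (fun N => routine_cost (ifft N)) (fun N => N%:R * ln N%:R : R).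

Lemma cost_direct_method_bigO :
  even_bigO (fun N => cost fft ifft (direct_method N))
            (fun N => N%:R ^+ 2 * ln N%:R : R).
Proof.
have [C C_ge0 fft_le] := even_bigO_near _ fftO.
have [D D_ge0 ifft_le] := even_bigO_near _ ifftO.
apply: (even_bigO_of_le _ _ (C + 13 + D)); first lra.
near=> N => N_even.
have L_ge1 : 1 <= ln (N%:R : R) by near: N; exact: near_ln_ge1.
have N_ge1 : 1 <= N%:R :> R by rewrite ler1n; near: N; exact: nbhs_infty_gt.
have a_le : (routine_cost (fft N))%:R <= C * (N%:R * ln N%:R) by move: N_even; near: N.
have b_le : (routine_cost (ifft N))%:R <= D * (N%:R * ln N%:R) by move: N_even; near: N.
have := cost_direct_method fft ifft N; rewrite -(ler_nat R) natrD !natrM natrD natrM.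
move: (N%:R : R) (ln (N%:R : R)) ((routine_cost (fft N))%:R : R)
  ((routine_cost (ifft N))%:R : R) ((cost fft ifft (direct_method N))%:R : R)
  L_ge1 N_ge1 a_le b_le.
move=> n L a b p L_ge1 n_ge1 a_le b_le p_le.
have n_ge0 : 0 <= n by lra.
have L_ge0 : 0 <= L by lra.
split; first by rewrite mulr_ge0// exprn_ge0.
have le1 : C * (n * L) <= C * (n ^+ 2 * L).
  by rewrite ler_wpM2l// ler_wpM2r// ler_eXnr.
have le2 : n * b <= n * (D * (n * L)) by rewrite ler_wpM2l.
have le3 : n ^+ 2 * 1 <= n ^+ 2 * L by rewrite ler_wpM2l// exprn_ge0.
lra.
Unshelve. all: by end_near. Qed.

Lemma cost_fast_method_bigO mu :
  even_bigO (fun N => cost fft ifft (fast_method R mu N))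
            (fun N => N%:R * ln N%:R ^+ 2 : R).
Proof.
have [C C_ge0 fft_le] := even_bigO_near _ fftO.
have [D D_ge0 ifft_le] := even_bigO_near _ ifftO.
have [E E_ge0 deg_le] := taylor_degree_le mu.
apply: (even_bigO_of_le _ _ (C + E * (29 + D) + E * 4 + 1)); first nra.
near=> N => N_even.
have L_ge1 : 1 <= ln (N%:R : R) by near: N; exact: near_ln_ge1.
have a_le : (routine_cost (fft N))%:R <= C * (N%:R * ln N%:R) by move: N_even; near: N.
have b_le : (routine_cost (ifft N))%:R <= D * (N%:R * ln N%:R) by move: N_even; near: N.
have T_le := deg_le N L_ge1.
have := cost_fast_method fft ifft R mu N.
move: (cost _ _ _) (taylor_degree mu N).+1 T_le => p T T_le.
rewrite -(ler_nat R) !natrD !natrM -[(_ * 4).+1%:R]natr1 natrD natrM natrM.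
move: (N%:R : R) (ln (N%:R : R)) ((routine_cost (fft N))%:R : R)
  ((routine_cost (ifft N))%:R : R) (T%:R : R)
  (p%:R : R) (ler0n R N)
  (ler0n R T) L_ge1 a_le b_le T_le.
move=> n L a b {}T q n_ge0 T_ge0 L_ge1 a_le b_le T_le q_le.
have L_ge0 : 0 <= L by lra.
have LL : L <= L ^+ 2 by rewrite ler_eXnr.
split; first by rewrite mulr_ge0// exprn_ge0.
have le1 : C * (n * L) <= C * (n * L ^+ 2) by rewrite ler_wpM2l// ler_wpM2l.
have le2 : T * (n * 29 + b) <= E * L * (n * 29 + D * (n * L)).
  apply: (@le_trans _ _ (T * (n * 29 + D * (n * L)))).
    by rewrite ler_wpM2l// lerD2l.
  by rewrite ler_wpM2r// addr_ge0 ?mulr_ge0.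
have le3 : n * (T * 4 + 1) <= n * (E * L * 4 + 1).
  by rewrite ler_wpM2l// lerD2r ler_wpM2r.
have le4 : E * n * L <= E * n * L ^+ 2 by rewrite ler_wpM2l// mulr_ge0.
have le5 : n * 1 <= n * L ^+ 2 by rewrite ler_wpM2l//; lra.
lra.
Unshelve. all: by end_near. Qed.

End Asymptotics.

Theorem theorem3p2 (R : realType) (m : nat) (mu : R)
    (m_gt0 : (0 < m)%N)
    (mu_large : mu * expR (mu + 1) >= m%:R + 2)
    (fft ifft : nat -> routine)
    (fftP : is_fast_transform (@dft R) fft)
    (ifftP : is_fast_transform (@idft R) ifft) :
  (exists fast_method : nat -> program,
     computes fft ifft fast_method (@fast_laplacian R mu) /\
     even_bigO (fun N => cost fft ifft (fast_method N))
               (fun N => N%:R * ln N%:R ^+ 2 : R))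
  /\
  (computes fft ifft direct_method (@direct_laplacian R) /\
   even_bigO (fun N => cost fft ifft (direct_method N))
             (fun N => N%:R ^+ 2 * ln N%:R : R)).
Proof.
have [fft_correct fftO] := fftP; have [ifft_correct ifftO] := ifftP.
split; last by split; [exact: direct_method_correct | exact: cost_direct_method_bigO].
exists (fast_method R mu).
by split; [exact: fast_method_correct | exact: cost_fast_method_bigO].
Qed.
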